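(* Let $A\in P(n)$ have all entries real and nonnegative, with $A_{ii}\neq 0$ for all $i$. Let $p=(1,\dots,1)^T$. The following are equivalent: (1) there exists a vector $u\in\mathbb R^n$ with nonnegative entries such that $Au=p$; (2) $I(sp,A)=I(A)$. Moreover, when these hold and $u$ is as in (1), set $y=I(A)\,u$. Then (a) the vector $x=(y_1^{1/2},\dots,y_n^{1/2})^T$ satisfies $\|x\|=1$ and $\|A\circ xx^*\|=I(sp,A)$ (spectral norm); (b) with $J=\{i:u_i\neq0\}$ and $A_J$ the principal submatrix of $A$ with rows and columns indexed by $J$, one has $I(A)=I(A_J)=I(sp,A_J)=I(sp,A)$.
   Context: $P(k)$ denotes positive semidefinite complex $k\times k$ matrices and $\circ$ the Hadamard (entrywise) product. For $C\in P(k)$, with $P_k$ the all-ones $k\times k$ matrix, $I(C)=\max\{\lambda\ge0: C-\lambda P_k\ge0\}$, and $I(sp,C)=\min\{\|C\circ B\|: B\in P(k),\ \|B\|=1\}$ with $\|\cdot\|$ the spectral norm. *)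

(* Defs.v *)
From HB Require Import structures.
From mathcomp Require Import all_boot all_order all_algebra.
From mathcomp Require Import complex.
From mathcomp Require Import classical_sets reals.
Set Implicit Arguments. Unset Strict Implicit. Unset Printing Implicit Defensive.
Import Order.TTheory GRing.Theory Num.Theory.
Local Open Scope ring_scope.
Local Open Scope classical_set_scope.

(* Complex numbers are R[i] for R : realType (mathcomp-real-closed);
   on R[i] the numeric order is the usual partial order of C:
   0 <= z  iff  z is real and nonnegative. *)

Definition ctr (R : realType) (m k : nat) (M : 'M[R[i]]_(m, k)) : 'M[R[i]]_(k, m) :=
  (map_mx Num.conj M)^T.

Definition psd (R : realType) (k : nat) (M : 'M[R[i]]_k) : Prop :=
  ctr M = M /\ forall x : 'cV[R[i]]_k, 0 <= (ctr x *m M *m x) 0 0.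

Definition hadamard (R : realType) (m k : nat) (A B : 'M[R[i]]_(m, k)) : 'M[R[i]]_(m, k) :=
  \matrix_(i, j) (A i j * B i j).

Definition vnorm (R : realType) (k : nat) (x : 'cV[R[i]]_k) : R :=
  Num.sqrt (\sum_i (ComplexField.Normc.normc (x i 0)) ^+ 2).

Definition specnorm (R : realType) (k : nat) (M : 'M[R[i]]_k) : R :=
  sup [set vnorm (M *m x) | x in [set x : 'cV[R[i]]_k | vnorm x = 1]].

Definition ones (R : realType) (k : nat) : 'M[R[i]]_k := const_mx 1.

Definition Ind (R : realType) (k : nat) (C : 'M[R[i]]_k) : R :=
  sup [set l : R | 0 <= l /\ psd (C - (l%:C)%C *: ones R k)].

Definition Isp (R : realType) (k : nat) (C : 'M[R[i]]_k) : R :=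
  inf [set specnorm (hadamard C B) | B in [set B : 'M[R[i]]_k | psd B /\ specnorm B = 1]].

Definition cvC (R : realType) (k : nat) (u : 'cV[R]_k) : 'cV[R[i]]_k :=
  map_mx (fun r => (r%:C)%C) u.

Definition princ (R : realType) (k : nat) (J : {set 'I_k}) (A : 'M[R[i]]_k)
  : 'M[R[i]]_#|J| :=
  mxsub (@enum_val _ (mem J)) (@enum_val _ (mem J)) A.

(* Main.v *)
(** Let [q_A] be the quadratic form of [A]. If [B] is positive semidefinite of norm 1,
    testing [A o B] on a unit eigenvector [w] of [B] shows that [||A o B||] is at least
    the minimum [m] of [q_A] on the probability simplex, while [A - Ind A *: ones >= 0]
    gives [Ind A <= m]; thus [Ind A <= m <= Isp A]. If [A u = p] with [u >= 0], then
    [Ind A = 1 / (sum of u)], and for [y = Ind A *: u], [x = sqrt y], AM-GM bounds the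
    form of [A o xx^*] by [Ind A], so all inequalities are equalities. Conversely, if
    [Isp A = Ind A], a minimizer [y] of [q_A] on the simplex is isotropic for the
    positive semidefinite matrix [A - Ind A *: ones], hence lies in its kernel, that is,
    [A y = Ind A *: p]. *)
Require Import Defs.
From HB Require Import structures.
From mathcomp Require Import all_boot all_order all_algebra.
From mathcomp Require Import complex.
From mathcomp Require Import classical_sets reals.
From mathcomp Require Import spectral topology normedtype derive ring lra.
Import Order.TTheory GRing.Theory Num.Theory.
Import numFieldNormedType.Exports.
Local Open Scope ring_scope.

Section HadamardIndices.
Context {R : realType}.
Local Open Scope complex_scope.
Local Open Scope ring_scope.
Local Notation C := R[i].
Local Notation normc := ComplexField.Normc.normc.
Local Notation p := (const_mx 1).

(** * Hermitian inner product and positive semidefinite forms *)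

Definition dot {k} (x y : 'cV[C]_k) : C := (ctr x *m y) 0 0.

Lemma ctr_mul {m k l} (M : 'M[C]_(m, k)) (N : 'M[C]_(k, l)) :
  ctr (M *m N) = ctr N *m ctr M.
Proof. by rewrite /ctr map_mxM trmx_mul. Qed.

Lemma ctrK {m k} (M : 'M[C]_(m, k)) : ctr (ctr M) = M.
Proof. by apply/matrixP => i j; rewrite !mxE conjCK. Qed.

Lemma dotE {k} (x y : 'cV[C]_k) : dot x y = \sum_i (x i 0)^* * y i 0.
Proof. by rewrite /dot mxE; apply: eq_bigr => i _; rewrite !mxE. Qed.

Lemma dotDr {k} (x y z : 'cV[C]_k) : dot x (y + z) = dot x y + dot x z.
Proof. by rewrite /dot mulmxDr mxE. Qed.

Lemma dotZr {k} c (x y : 'cV[C]_k) : dot x (c *: y) = c * dot x y.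
Proof. by rewrite /dot -scalemxAr mxE. Qed.

Lemma dotC {k} (x y : 'cV[C]_k) : dot y x = (dot x y)^*.
Proof.
rewrite !dotE rmorph_sum; apply: eq_bigr => i _.
by rewrite rmorphM /= conjCK mulrC.
Qed.

Lemma dotDl {k} (x y z : 'cV[C]_k) : dot (x + y) z = dot x z + dot y z.
Proof. by rewrite dotC dotDr rmorphD /= -!dotC. Qed.

Lemma dotZl {k} c (x y : 'cV[C]_k) : dot (c *: x) y = c^* * dot x y.
Proof. by rewrite dotC dotZr rmorphM /= -dotC. Qed.

Lemma dot_sumr {k} (I : finType) (x : 'cV[C]_k) (y : I -> 'cV[C]_k) :
  dot x (\sum_l y l) = \sum_l dot x (y l).
Proof. by rewrite /dot mulmx_sumr summxE. Qed.

Lemma dot_adj {k m} (M : 'M[C]_(k, m)) (x : 'cV[C]_k) (y : 'cV[C]_m) :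
  dot x (M *m y) = dot (ctr M *m x) y.
Proof. by rewrite /dot ctr_mul ctrK mulmxA. Qed.

Lemma normCc (z : C) : (normc z)%:C = `|z|.
Proof. by []. Qed.

Lemma vnorm_ge0 {k} (x : 'cV[C]_k) : 0 <= vnorm x.
Proof. exact: sqrtr_ge0. Qed.

Lemma dotxx {k} (x : 'cV[C]_k) : dot x x = (vnorm x ^+ 2)%:C.
Proof.
rewrite /vnorm sqr_sqrtr; last by apply: sumr_ge0 => i _; rewrite sqr_ge0.
rewrite dotE rmorph_sum; apply: eq_bigr => i _.
by rewrite rmorphXn /= normCc normCK mulrC.
Qed.

Lemma dotxx_ge0 {k} (x : 'cV[C]_k) : 0 <= dot x x.
Proof. by rewrite dotxx ler0c sqr_ge0. Qed.

Lemma dotxx_eq0 {k} (x : 'cV[C]_k) : dot x x = 0 -> x = 0.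
Proof.
rewrite dotE => /eqP; rewrite psumr_eq0; last first.
  by move=> i _; rewrite mulrC -normCK exprn_ge0.
move=> /allP x0; apply/matrixP => i j; rewrite ord1 mxE.
have := x0 i (mem_index_enum _); rewrite /= mulrC -normCK expf_eq0 /= normr_eq0.
by move/eqP.
Qed.

Lemma psdE {k} (M : 'M[C]_k) :
  psd M <-> ctr M = M /\ forall x, 0 <= dot x (M *m x).
Proof.
by rewrite /psd /dot; split=> -[? H]; split=> // x; have := H x; rewrite mulmxA.
Qed.

Lemma psd_dot_ge0 {k} (M : 'M[C]_k) x : psd M -> 0 <= dot x (M *m x).
Proof. by case/psdE => _. Qed.

Lemma psd_dotC {k} (M : 'M[C]_k) x y : psd M -> dot x (M *m y) = dot (M *m x) y.
Proof. by case=> hM _; rewrite dot_adj hM. Qed.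

(* Expanding [x - c y] in a positive form, with [c] chosen by each user,
   replaces every appeal to the Cauchy-Schwarz inequality. *)
Lemma psd_dot_sub {k} (M : 'M[C]_k) x y c : psd M ->
  dot (x - c *: y) (M *m (x - c *: y)) =
  dot x (M *m x) - c * dot x (M *m y) - (c * dot x (M *m y))^*
  + `|c| ^+ 2 * dot y (M *m y).
Proof.
move=> pM; rewrite -scaleNr mulmxDr -scalemxAr !dotDl !dotDr !dotZl !dotZr.
rewrite (psd_dotC _ y x pM) (dotC x (M *m y)) rmorphM rmorphN normCK /=; ring.
Qed.

Lemma psd1 {k} : psd (1%:M : 'M[C]_k).
Proof.
apply/psdE; split; last by move=> x; rewrite mul1mx dotxx_ge0.
by rewrite /ctr map_mx1 trmx1.
Qed.

Lemma dot_sub {k} (x y : 'cV[C]_k) c :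
  dot (x - c *: y) (x - c *: y) =
  dot x x - c * dot x y - (c * dot x y)^* + `|c| ^+ 2 * dot y y.
Proof. by have := psd_dot_sub 1%:M x y c psd1; rewrite !mul1mx. Qed.

Lemma realC_conj (r : R) : (r%:C)^* = r%:C :> C.
Proof. by apply/CrealP/complex_realP; exists r. Qed.

Lemma psd_dot_real {k} (M : 'M[C]_k) x : psd M ->
  exists2 r : R, 0 <= r & dot x (M *m x) = r%:C.
Proof.
move=> pM; have p0 := psd_dot_ge0 M x pM.
have /ger0_real/complex_realP[r rE] := p0.
by exists r => //; rewrite -ler0c -rE.
Qed.

(** If [M x] were nonzero, a small step from the isotropic [x] along [-M x] would make the form
    negative: the change is [- 2 c a + c^2 b], with [a = |M x|^2] and [b] the form at [M x]. *)
Lemma psd_dot_eq0 {k} (M : 'M[C]_k) x : psd M -> dot x (M *m x) = 0 -> M *m x = 0.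
Proof.
move=> pM q0; apply: dotxx_eq0.
have [b b0 bE] := psd_dot_real M (M *m x) pM.
have aE := dotxx (M *m x); set a := vnorm _ ^+ 2 in aE.
have a0 : 0 <= a by rewrite sqr_ge0.
(* The step [c = a / (b + 1)] is small enough, and [b + 1] is positive even when [b = 0]. *)
have := psd_dot_ge0 M (x - (a / (b + 1))%:C *: (M *m x)) pM.
rewrite psd_dot_sub // q0 (psd_dotC _ x) // aE bE -!rmorphM realC_conj.
rewrite ger0_norm; last by rewrite ler0c divr_ge0 // addr_ge0.
rewrite -rmorphXn -rmorphM -!rmorphN /= -[0]/((0:R)%:C) -!rmorphD /= lecR.
move=> h; congr (_%:C); apply/eqP; rewrite eq_le a0 andbT leNgt; apply/negP => a1.
have b1 : 0 < b + 1 by rewrite ltr_wpDl.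
have := mulr_ge0 (ltW b1) h.
have -> : (b + 1) * (0 - a / (b + 1) * a - a / (b + 1) * a + (a / (b + 1)) ^+ 2 * b)
  = a ^+ 2 * (b / (b + 1) - 2).
  by field; rewrite gt_eqF.
have a2 : 0 < a ^+ 2 by exact: exprn_gt0.
by rewrite (pmulr_rge0 _ a2) subr_ge0 ler_pdivlMr //; lra.
Qed.

(** * Spectral norm of positive semidefinite matrices *)

Lemma specnorm_set_bounded {k} (M : 'M[C]_k) :
  has_ubound [set vnorm (M *m x) | x in [set x : 'cV[C]_k | vnorm x = 1]].
Proof.
exists (Num.sqrt (\sum_i (\sum_j normc (M i j)) ^+ 2)) => _ [x /= x1 <-].
rewrite /vnorm ler_sqrt; last by apply: sumr_ge0 => i _; rewrite sqr_ge0.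
have nc0 (z : C) : 0 <= normc z by rewrite -ler0c normCc.
have xj j : normc (x j 0) <= 1.
  rewrite -(@ler_pXn2r _ 2) ?nnegrE // expr1n -(expr1n _ 2) -[in leRHS]x1.
  rewrite sqr_sqrtr; last by apply: sumr_ge0 => i _; rewrite sqr_ge0.
  by rewrite (bigD1 j) //= lerDl; apply: sumr_ge0 => i _; rewrite sqr_ge0.
apply: ler_sum => i _; rewrite ler_pXn2r ?nnegrE ?sumr_ge0 // mxE.
rewrite -lecR normCc rmorph_sum; apply: le_trans (ler_norm_sum _ _ _) _.
apply: ler_sum => j _; rewrite normrM /= normCc ler_piMr //.
by rewrite -normCc -[1]/((1:R)%:C) lecR.
Qed.

Lemma specnorm_ge0 {k} (M : 'M[C]_k) : 0 <= specnorm M.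
Proof.
rewrite /specnorm; set S := (X in sup X).
(* For [k = 0] there is no unit vector, and [sup] takes its default value 0. *)
have [->|/set0P [v Sv]] := eqVneq S set0; first by rewrite sup0.
apply: le_trans (ub_le_sup (specnorm_set_bounded M) Sv).
by case: Sv => x _ <-; exact: vnorm_ge0.
Qed.

(** Expanding [|M x - c x|^2 >= 0] with [c] the form at [x] gives [c^2 <= |M x|^2]. *)
Lemma specnorm_ge {k} (M : 'M[C]_k) x : psd M -> vnorm x = 1 ->
  dot x (M *m x) <= (specnorm M)%:C.
Proof.
move=> pM x1; apply: (@le_trans _ _ (vnorm (M *m x))%:C); last first.
  rewrite lecR; apply: ub_le_sup; first exact: specnorm_set_bounded.
  by exists x.
have [c c0 cE] := psd_dot_real M x pM.
have := dotxx_ge0 (M *m x - c%:C *: x); rewrite dot_sub -(psd_dotC _ x x) // cE.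
rewrite !dotxx x1 expr1n mulr1 ger0_norm ?ler0c // -rmorphM realC_conj -rmorphXn.
rewrite -!rmorphN -!rmorphD ler0c lecR => h.
rewrite -(@ler_pXn2r _ 2) ?nnegrE ?vnorm_ge0 //; lra.
Qed.

(** Positivity at [x - M x / m] gives [2 m |M x|^2 <= m^2 q + t], where the forms [q] at [x] and [t]
    at [M x] are at most [m] and [m |M x|^2]. Hence [|M x|^2 <= m^2]. *)
Lemma specnorm_le {k} (M : 'M[C]_k) (m : R) : psd M -> 0 < m ->
  (forall x, dot x (M *m x) <= m%:C * dot x x) -> specnorm M <= m.
Proof.
move=> pM m0 Mm; rewrite /specnorm.
set S := (X in sup X); have [->|/set0P S0] := eqVneq S set0.
  by rewrite sup0 ltW.
apply: ge_sup => // _ [x /= x1 <-].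
have [q q0 qE] := psd_dot_real M x pM.
have [t t0 tE] := psd_dot_real M (M *m x) pM.
have := Mm x; rewrite qE dotxx x1 expr1n mulr1 lecR => qm.
have := Mm (M *m x); rewrite tE dotxx -rmorphM lecR => tm.
have := psd_dot_ge0 M (x - (m^-1)%:C *: (M *m x)) pM.
rewrite psd_dot_sub // (psd_dotC _ x (M *m x)) // dotxx qE tE -rmorphM realC_conj.
rewrite ger0_norm; last by rewrite ler0c invr_ge0 ltW.
rewrite -rmorphXn -!rmorphM -!rmorphN /= -!rmorphD /= ler0c => h.
set a := vnorm _ in tm h *.
have m2 : 0 < m ^+ 2 by exact: exprn_gt0.
have := mulr_ge0 (ltW m2) h.
have -> : m ^+ 2 * (q - m^-1 * a ^+ 2 - m^-1 * a ^+ 2 + m^-1 ^+ 2 * t)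
   = m ^+ 2 * q - 2 * m * a ^+ 2 + t by field; rewrite gt_eqF.
move=> h2; rewrite -(@ler_pXn2r _ 2) ?nnegrE ?vnorm_ge0 ?(ltW m0) //.
rewrite -(ler_pM2l m0).
have : m ^+ 2 * q <= m ^+ 2 * m by rewrite ler_pM2l.
have -> : m * m ^+ 2 = m ^+ 2 * m by ring.
lra.
Qed.

(** * Rank-one matrices, spectral decomposition and Schur products *)

Lemma dot_rank1 {k} (w z : 'cV[C]_k) :
  dot z (w *m ctr w *m z) = `|dot w z| ^+ 2.
Proof.
by rewrite /dot -mulmxA mulmxA mxE big_ord1 -/(dot z w) -/(dot w z) dotC mulrC normCK.
Qed.

Lemma psd_rank1 {k} (w : 'cV[C]_k) : psd (w *m ctr w).
Proof.
apply/psdE; split; first by rewrite ctr_mul ctrK.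
by move=> z; rewrite dot_rank1 exprn_ge0.
Qed.

(** The eigenvectors [w l] are the columns of the adjoint of a diagonalizing unitary matrix; their
    orthogonality is exported as Parseval's identity. *)
Lemma psd_spectral {k} (B : 'M[C]_k) : psd B ->
  exists (d : 'I_k -> C) (w : 'I_k -> 'cV[C]_k),
  [/\ forall l, 0 <= d l, forall l, dot (w l) (w l) = 1,
      forall z, dot z z = \sum_l `|dot (w l) z| ^+ 2
    & B = \sum_l d l *: (w l *m ctr (w l))].
Proof.
move=> pB; have [hB _] := pB.
have ctrE m l (M : 'M[C]_(m, l)) : map_mx Num.conj (M^T) = ctr M.
  by rewrite /ctr map_trmx.
have Bherm : B \is hermsymmx.
  by apply/is_hermitianmxP; rewrite expr0 scale1r ctrE hB.
have /hermitian_normalmx/orthomx_spectralP := Bherm.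
have := spectral_unitarymx B; set P := spectralmx B => uP.
rewrite invmx_unitary // ctrE; set D := spectral_diag B => BE.
have PP : P *m ctr P = 1%:M by have /unitarymxP := uP; rewrite ctrE.
have PP' : ctr P *m P = 1%:M by apply: mulmx1C.
pose w l := col l (ctr P).
have dec (e : 'rV[C]_k) :
    ctr P *m diag_mx e *m P = \sum_l e 0 l *: (w l *m ctr (w l)).
  apply/matrixP => i j; rewrite mul_mx_diag mxE summxE; apply: eq_bigr => l _.
  by rewrite !mxE big_ord1 !mxE conjCK; ring.
have ww l m : dot (w l) (w m) = (l == m)%:R.
  have /matrixP/(_ l m) := PP; rewrite !mxE => <-.
  by rewrite dotE; apply: eq_bigr => i _; rewrite !mxE conjCK.
have dotdec (e : 'rV[C]_k) z : dot z ((\sum_l e 0 l *: (w l *m ctr (w l))) *m z)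
    = \sum_l e 0 l * `|dot (w l) z| ^+ 2.
  rewrite mulmx_suml dot_sumr; apply: eq_bigr => l _.
  by rewrite -scalemxAl dotZr dot_rank1.
exists (D 0), w; split.
- move=> l; have := psd_dot_ge0 B (w l) pB; rewrite BE dec dotdec (bigD1 l) //=.
  rewrite ww eqxx normr1 expr1n mulr1 big1 ?addr0 // => i /negbTE il.
  by rewrite ww il normr0 expr0n mulr0.
- by move=> l; rewrite ww eqxx.
(* Parseval is the decomposition with all coefficients 1, since [ctr P *m P = 1]. *)
- move=> z; have := dotdec (const_mx 1) z.
  rewrite -dec diag_const_mx mulmx1 PP' mul1mx => ->.
  by apply: eq_bigr => l _; rewrite mxE mul1r.
- by rewrite BE dec.
Qed.

(** The Hadamard product with [w w^*] is the congruence [diag(w) A diag(w)^*], and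
    [t = diag(w)^* z]. *)
Lemma hadamard_rank1 {k} (A : 'M[C]_k) (w z : 'cV[C]_k) :
  let t := \col_i ((w i 0)^* * z i 0) in
  dot z (hadamard A (w *m ctr w) *m z) = dot t (A *m t).
Proof.
move=> t; rewrite !dotE; apply: eq_bigr => i _; rewrite !mxE rmorphM /= conjCK.
rewrite !mulr_sumr; apply: eq_bigr => j _.
by rewrite !mxE big_ord1 !mxE; ring.
Qed.

Lemma hadamard_sumZ {k} (A : 'M[C]_k) (I : finType) (d : I -> C) (B : I -> 'M[C]_k) :
  hadamard A (\sum_l d l *: B l) = \sum_l d l *: hadamard A (B l).
Proof.
apply/matrixP => i j; rewrite !mxE !summxE mulr_sumr; apply: eq_bigr => l _.
by rewrite !mxE mulrCA.
Qed.

(** Schur product theorem: by the spectral decomposition of [B], [A o B] is a nonnegative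
    combination of congruences of [A]. *)
Lemma psd_hadamard {k} (A B : 'M[C]_k) : psd A -> psd B -> psd (hadamard A B).
Proof.
move=> pA pB; have [hA _] := pA; have [hB _] := pB; apply/psdE; split.
  apply/matrixP => i j; rewrite !mxE -{2}hA -{2}hB rmorphM !mxE //.
have [d [w [d0 _ _ ->]]] := psd_spectral B pB => z.
rewrite hadamard_sumZ mulmx_suml dot_sumr; apply: sumr_ge0 => l _.
by rewrite -scalemxAl dotZr hadamard_rank1 mulr_ge0 // psd_dot_ge0.
Qed.

Lemma dot1_vnorm {k} (x : 'cV[C]_k) : dot x x = 1 -> vnorm x = 1.
Proof.
rewrite dotxx => /complexI/eqP.
by rewrite sqrp_eq1 ?vnorm_ge0 // => /eqP.
Qed.

(* Testing [A o B] on an eigenvector [w] of [B] evaluates the form of [A] at the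
   probability vector [(|w_i|^2)_i], up to the eigenvalue. *)
Lemma specnorm_hadamard_ge {k} (A B : 'M[C]_k) (m : R) : psd A -> 0 < m ->
  (forall y : 'cV[R]_k, (forall i, 0 <= y i 0) -> \sum_i y i 0 = 1 ->
     m%:C <= dot (cvC y) (A *m cvC y)) ->
  psd B -> specnorm B = 1 -> m <= specnorm (hadamard A B).
Proof.
move=> pA m0 Am pB B1; rewrite leNgt; apply/negP => Bm.
have [d [w [d0 w1 wz BE]]] := psd_spectral B pB.
set s := specnorm _ in Bm.
have ds l : d l * m%:C <= s%:C.
  apply: le_trans (specnorm_ge _ _ (psd_hadamard _ _ pA pB) (dot1_vnorm _ (w1 l))).
  rewrite BE hadamard_sumZ mulmx_suml dot_sumr (bigD1 l) //=.
  rewrite -scalemxAl dotZr hadamard_rank1 ler_wpDr //.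
    apply: sumr_ge0 => j _; rewrite -scalemxAl dotZr mulr_ge0 //.
    by rewrite hadamard_rank1 psd_dot_ge0.
  apply: ler_wpM2l => //.
  pose y : 'cV[R]_k := \col_i (normc (w l i 0)) ^+ 2.
  have -> : \col_i ((w l i 0)^* * w l i 0) = cvC y.
    by apply/matrixP => i j; rewrite !mxE rmorphXn /= normCc normCK mulrC.
  apply: Am => [i|]; first by rewrite mxE sqr_ge0.
  apply: (@complexI R); rewrite -[RHS]/(1 : C) -[RHS](w1 l) dotE rmorph_sum.
  apply: eq_bigr => i _.
  by rewrite !mxE rmorphXn /= normCc normCK mulrC.
(* Eigenvalues at most [s / m < 1] force the norm of [B] below 1; the alternative [2^-1] keeps the
   bound positive when [s = 0]. *)
pose M := Num.max (s / m) (2^-1).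
have M1 : M < 1 by rewrite gt_max ltr_pdivrMr // mul1r Bm invf_lt1 // ltr1n.
have M0 : 0 < M by rewrite lt_max invr_gt0 ltr0n orbT.
suff : specnorm B <= M by rewrite B1 leNgt M1.
apply: specnorm_le => // x; rewrite wz BE mulmx_suml dot_sumr mulr_sumr.
apply: ler_sum => l _; rewrite -scalemxAl dotZr dot_rank1 ler_wpM2r ?exprn_ge0 //.
apply: (@le_trans _ _ (s / m)%:C); last by rewrite lecR le_max lexx.
by rewrite rmorphM fmorphV ler_pdivlMr // -[0]/((0:R)%:C) ltcR.
Qed.

(** * The index [Ind] *)

Lemma onesE {k} : ones R k = (p : 'cV[C]_k) *m ctr p.
Proof. by apply/matrixP => i j; rewrite !mxE big_ord1 !mxE conjC1 mulr1. Qed.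

Lemma dot_p_cvC {k} (u : 'cV[R]_k) : dot p (cvC u) = (\sum_i u i 0)%:C.
Proof.
by rewrite dotE rmorph_sum; apply: eq_bigr => i _; rewrite !mxE conjC1 mul1r.
Qed.

Lemma dot_sub_ones {k} (A : 'M[C]_k) (l : R) z :
  dot z ((A - l%:C *: ones R k) *m z) = dot z (A *m z) - l%:C * `|dot p z| ^+ 2.
Proof.
by rewrite onesE mulmxBl -scalemxAl -scaleNr dotDr dotZr dot_rank1 mulNr.
Qed.

(** As [ones] is the rank-one matrix [p p^*], membership in the set defining [Ind] becomes a family
    of inequalities linear in [l]. *)
Lemma psd_sub_ones {k} (A : 'M[C]_k) (l : R) : psd A ->
  psd (A - l%:C *: ones R k) <->
  forall z, l%:C * `|dot p z| ^+ 2 <= dot z (A *m z).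
Proof.
move=> [hA _]; split=> [pl z|H].
  by have := psd_dot_ge0 _ z pl; rewrite dot_sub_ones subr_ge0.
apply/psdE; split=> [|z]; last by rewrite dot_sub_ones subr_ge0.
apply/matrixP => i j; rewrite !mxE rmorphB rmorphM /= conjC1 realC_conj.
by have /matrixP/(_ i j) := hA; rewrite !mxE => ->.
Qed.

Lemma Ind_set_bounded {k} (A : 'M[C]_k) : (0 < k)%N -> psd A ->
  has_ubound [set l : R | 0 <= l /\ psd (A - l%:C *: ones R k)].
Proof.
move=> k0 pA; pose e : 'cV[C]_k := delta_mx (Ordinal k0) 0.
have [r _ rE] := psd_dot_real A e pA.
exists r => l [l0 /(psd_sub_ones _ _ pA)/(_ e)]; rewrite rE.
have -> : dot p e = 1.
  rewrite dotE (bigD1 (Ordinal k0)) //= big1 => [|i /negbTE ik].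
    by rewrite !mxE !eqxx conjC1 addr0 mulr1.
  by rewrite !mxE ik mulr0.
by rewrite normr1 expr1n mulr1 lecR.
Qed.

(** The supremum is attained: for fixed [z] the condition is an upper bound on [l], which passes to
    the supremum, or plain positivity of [A] when [dot p z = 0]. *)
Lemma Ind_psd {k} (A : 'M[C]_k) : (0 < k)%N -> psd A ->
  psd (A - (Ind A)%:C *: ones R k).
Proof.
move=> k0 pA; apply/psd_sub_ones => // z.
have [q q0 qE] := psd_dot_real A z pA.
rewrite qE -normCc -rmorphXn -rmorphM lecR.
have [->|z0] := eqVneq (normc (dot p z)) 0; first by rewrite expr0n mulr0.
have n0 : 0 < normc (dot p z) ^+ 2 by rewrite exprn_even_gt0.
rewrite -ler_pdivlMr //; apply: ge_sup.
  exists 0; split => //; apply/psd_sub_ones => // x.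
  by rewrite rmorph0 mul0r psd_dot_ge0.
move=> l [l0 /(psd_sub_ones _ _ pA)/(_ z)].
by rewrite qE -normCc -rmorphXn -rmorphM lecR ler_pdivlMr.
Qed.

Lemma Ind_le {k} (A : 'M[C]_k) (y : 'cV[R]_k) : (0 < k)%N -> psd A ->
  \sum_i y i 0 = 1 -> (Ind A)%:C <= dot (cvC y) (A *m cvC y).
Proof.
move=> k0 pA y1; have /(psd_sub_ones _ _ pA)/(_ (cvC y)) := Ind_psd A k0 pA.
by rewrite dot_p_cvC y1 normr1 expr1n mulr1.
Qed.

(** With [s] the coordinate sum of [u], the form at [u] is [s]. Testing there gives
    [Ind A * s^2 <= s]; conversely Cauchy-Schwarz for the form of [A] gives
    [|dot p z|^2 <= s * dot z (A z)], so [s^-1] is admissible. *)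
Lemma Ind_solution {k} (A : 'M[C]_k) (u : 'cV[R]_k) : (0 < k)%N -> psd A ->
  A *m cvC u = p -> 0 < \sum_i u i 0 /\ Ind A = (\sum_i u i 0)^-1.
Proof.
move=> k0 pA Au; have := dot_p_cvC u; set s := \sum_i u i 0 => pu.
have uAu : dot (cvC u) (A *m cvC u) = s%:C.
  by rewrite Au dotC pu realC_conj.
have s0 : 0 < s.
  rewrite lt_neqAle eq_sym -ler0c -uAu psd_dot_ge0 // andbT.
  apply/eqP => s0; have := psd_dot_eq0 A (cvC u) pA; rewrite uAu s0 => /(_ erefl).
  rewrite Au => /matrixP/(_ (Ordinal k0) 0); rewrite !mxE => /eqP.
  by rewrite oner_eq0.
split=> //; apply/eqP; rewrite eq_le; apply/andP; split.
  have /(psd_sub_ones _ _ pA)/(_ (cvC u)) := Ind_psd A k0 pA.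
  rewrite uAu pu -normCc /= expr0n addr0 sqrtr_sqr gtr0_norm // -rmorphXn -rmorphM.
  by rewrite lecR expr2 mulrA ger_pMl // -ler_pdivlMr // div1r.
apply: ub_le_sup; first exact: Ind_set_bounded.
split; first by rewrite invr_ge0 ltW.
apply/psd_sub_ones => // z; rewrite -Au -(psd_dotC A) //.
set h := dot (cvC u) (A *m z).
have := psd_dot_ge0 _ (z - ((s^-1)%:C * h) *: cvC u) pA.
rewrite psd_dot_sub // uAu (dot_adj A z (cvC u)) (proj1 pA) (dotC (cvC u)) -/h.
have -> : (s^-1)%:C * h * h^* = (s^-1)%:C * `|h| ^+ 2 by rewrite normCK mulrA.
rewrite -[`|h|]normCc -rmorphXn -rmorphM realC_conj normrM ger0_norm; last first.
  by rewrite ler0c invr_ge0 ltW.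
rewrite -[`|h|]normCc -rmorphM -rmorphXn -rmorphM.
have -> : (s^-1 * normc h) ^+ 2 * s = s^-1 * normc h ^+ 2 by field; rewrite gt_eqF.
by rewrite subrK subr_ge0.
Qed.

(** * Bounds on [Isp] and their attainment by a rank-one matrix *)

(** The upper bound is Bessel's inequality, from the residual of projecting [z] onto [x]; the lower
    bound evaluates the form at [x]. *)
Lemma specnorm_rank1 {k} (x : 'cV[C]_k) : vnorm x = 1 -> specnorm (x *m ctr x) = 1.
Proof.
move=> x1; have xx : dot x x = 1 by rewrite dotxx x1 expr1n.
apply/eqP; rewrite eq_le; apply/andP; split.
  apply: specnorm_le => // [|z]; first exact: psd_rank1.
  rewrite dot_rank1 mul1r; have := dotxx_ge0 (z - dot x z *: x).
  rewrite dot_sub xx mulr1 (dotC x z) -normCK -normCc -rmorphXn realC_conj.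
  by rewrite subrK subr_ge0.
have := specnorm_ge _ _ (psd_rank1 x) x1.
by rewrite dot_rank1 xx normr1 expr1n -[1]/((1:R)%:C) lecR.
Qed.

Lemma Isp_ge {k} (A : 'M[C]_k) (m : R) : (0 < k)%N -> psd A -> 0 < m ->
  (forall y : 'cV[R]_k, (forall i, 0 <= y i 0) -> \sum_i y i 0 = 1 ->
     m%:C <= dot (cvC y) (A *m cvC y)) ->
  m <= Isp A.
Proof.
move=> k0 pA m0 Am; apply: lb_le_inf => [|_ [B /= [pB B1] <-]]; last first.
  exact: specnorm_hadamard_ge.
(* A lower bound passes to [inf] only for a nonempty set; the projection onto a basis vector is a
   witness. *)
pose e : 'cV[C]_k := delta_mx (Ordinal k0) 0.
exists (specnorm (hadamard A (e *m ctr e))); exists (e *m ctr e) => //.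
split; first exact: psd_rank1.
apply/specnorm_rank1/dot1_vnorm.
rewrite dotE (bigD1 (Ordinal k0)) //= big1 => [|i /negbTE ik].
  by rewrite !mxE !eqxx conjC1 addr0 mulr1.
by rewrite !mxE ik mulr0.
Qed.

Lemma Isp_le {k} (A B : 'M[C]_k) : psd A -> psd B -> specnorm B = 1 ->
  Isp A <= specnorm (hadamard A B).
Proof.
move=> pA pB B1; apply: ge_inf; last by exists B.
exists 0 => _ [D _ <-]; exact: specnorm_ge0.
Qed.

Lemma Re_nonneg (z : C) : 0 <= z -> 0 <= complex.Re z /\ z = (complex.Re z)%:C.
Proof.
move=> z0; have zE := RRe_real (ger0_real z0); split=> //.
by rewrite -ler0c zE.
Qed.

(* AM-GM in the form [(x_i n_i) (x_j n_j) <= (n_i^2 x_j^2 + n_j^2 x_i^2) / 2], summed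
   against the nonnegative entries of [A], leaves the row sums [(A y)_i = l]. *)
Lemma quad_hadamard_le {k} (A : 'M[C]_k) (y : 'cV[R]_k) (l : R) :
  psd A -> (forall i j, 0 <= A i j) -> (forall i, 0 <= y i 0) ->
  A *m cvC y = const_mx l%:C ->
  let x := cvC (map_mx Num.sqrt y) in
  forall z, dot z (hadamard A (x *m ctr x) *m z) <= l%:C * dot z z.
Proof.
move=> pA A0 y0 Ay x z; set t := \col_i ((x i 0)^* * z i 0).
pose a i j := complex.Re (A i j); pose n i := normc (z i 0); pose r i := Num.sqrt (y i 0).
have aE i j : A i j = (a i j)%:C by case: (Re_nonneg _ (A0 i j)).
have a0 i j : 0 <= a i j by case: (Re_nonneg _ (A0 i j)).
have aC i j : a i j = a j i.
  apply: (@complexI R); rewrite -!aE.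
  by have /matrixP/(_ j i) := proj1 pA; rewrite !mxE => <-; rewrite aE realC_conj.
have rowy i : \sum_j a i j * y j 0 = l.
  apply: (@complexI R); have /matrixP/(_ i 0) := Ay; rewrite !mxE => <-.
  by rewrite rmorph_sum; apply: eq_bigr => j _; rewrite rmorphM mxE aE.
have tn i : `|t i 0| = (r i * n i)%:C.
  rewrite !mxE realC_conj normrM ger0_norm ?ler0c ?sqrtr_ge0 //.
  by rewrite rmorphM.
have r2 i : r i ^+ 2 = y i 0 by rewrite sqr_sqrtr.
have n2 : dot z z = (\sum_i n i ^+ 2)%:C.
  by rewrite dotxx sqr_sqrtr // sumr_ge0 // => i _; rewrite sqr_ge0.
have h0 : 0 <= dot t (A *m t) by exact: psd_dot_ge0.
(* The form is nonnegative, hence equal to its modulus, and the triangle inequality leads to a real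
   sum in [|t_i| = r_i n_i]. *)
rewrite hadamard_rank1 -/t -(ger0_norm h0) dotE n2 -rmorphM.
apply: (@le_trans _ _ (\sum_i \sum_j a i j * (r i * n i * (r j * n j)))%:C).
  rewrite rmorph_sum; apply: le_trans (ler_norm_sum _ _ _) _; apply: ler_sum => i _.
  rewrite normrM norm_conjC tn mxE.
  apply: (@le_trans _ _ ((r i * n i)%:C * \sum_j `|A i j * t j 0|)).
    by rewrite ler_wpM2l ?ler_norm_sum // -tn.
  rewrite rmorph_sum mulr_sumr; apply: ler_sum => j _.
  rewrite normrM tn aE ger0_norm ?ler0c // -!rmorphM lecR le_eqVlt; apply/orP; left.
  by apply/eqP; ring.
rewrite lecR.
apply: (@le_trans _ _ (\sum_i \sum_j a i j * (2^-1 * (n i ^+ 2 * y j 0 + n j ^+ 2 * y i 0)))).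
  apply: ler_sum => i _; apply: ler_sum => j _; apply: ler_wpM2l => //.
  rewrite -!r2; have := sqr_ge0 (n i * r j - n j * r i); nra.
rewrite le_eqVlt; apply/orP; left; apply/eqP.
have S1 : \sum_i \sum_j a i j * (n i ^+ 2 * y j 0) = l * \sum_i n i ^+ 2.
  rewrite mulr_sumr; apply: eq_bigr => i _; rewrite -(rowy i) mulr_suml.
  by apply: eq_bigr => j _; ring.
have S2 : \sum_i \sum_j a i j * (n j ^+ 2 * y i 0) = l * \sum_i n i ^+ 2.
  rewrite -S1 exchange_big; apply: eq_bigr => i _; apply: eq_bigr => j _.
  by rewrite aC.
transitivity (2^-1 * (l * \sum_i n i ^+ 2 + l * \sum_i n i ^+ 2)); last by field.
rewrite -{1}S1 -S2 -big_split mulr_sumr; apply: eq_bigr => i _.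
rewrite -big_split mulr_sumr; apply: eq_bigr => j _ /=; ring.
Qed.

(** The chain [Ind A <= Isp A <= ||A o xx^*|| <= Ind A] closes: the second bound holds because
    [xx^*] has norm 1, the last by AM-GM. *)
Lemma solution_Isp {k} (A : 'M[C]_k) (u : 'cV[R]_k) :
  (0 < k)%N -> psd A -> (forall i j, 0 <= A i j) -> (forall i, 0 <= u i 0) ->
  A *m cvC u = p ->
  let x := cvC (map_mx Num.sqrt (Ind A *: u)) in
  [/\ vnorm x = 1, specnorm (hadamard A (x *m ctr x)) = Isp A & Isp A = Ind A].
Proof.
move=> k0 pA A0 u0 Au x; have [s0 IE] := Ind_solution A u k0 pA Au.
set s := \sum_i u i 0 in s0 IE.
have I0 : 0 < Ind A by rewrite IE invr_gt0.
pose y := Ind A *: u.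
have y0 i : 0 <= y i 0 by rewrite mxE mulr_ge0 // ltW.
have y1 : \sum_i y i 0 = 1.
  under eq_bigr do rewrite mxE.
  by rewrite -mulr_sumr IE mulVf // gt_eqF.
have Ay : A *m cvC y = const_mx (Ind A)%:C.
  have -> : cvC y = (Ind A)%:C *: cvC u.
    by apply/matrixP => i j; rewrite !mxE rmorphM.
  by rewrite -scalemxAr Au; apply/matrixP => i j; rewrite !mxE mulr1.
have x1 : vnorm x = 1.
  apply: dot1_vnorm; rewrite dotE -[RHS]/((1:R)%:C) -y1 rmorph_sum.
  apply: eq_bigr => i _; rewrite [x i 0]mxE realC_conj -rmorphM [in LHS]mxE.
  by rewrite -expr2 sqr_sqrtr.
have pX := psd_rank1 x; have X1 := specnorm_rank1 x x1.
have ub : specnorm (hadamard A (x *m ctr x)) <= Ind A.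
  by apply: specnorm_le => //; [exact: psd_hadamard | exact: quad_hadamard_le].
have lb : Ind A <= Isp A by apply: Isp_ge => // v _ v1; exact: Ind_le.
have IX := Isp_le A _ pA pX X1.
split=> //; apply/eqP; rewrite eq_le ?IX ?lb ?andbT; first exact: le_trans lb.
exact: le_trans ub.
Qed.

(** * Minimizers on the simplex and the converse implication *)

(** The simplex is a closed part of the cube [[0,1]^k], hence compact, and the form is continuous.
    Row vectors match the topological lemmas applied. *)
Lemma simplex_quad_min {k} (a : 'I_k -> 'I_k -> R) : (0 < k)%N ->
  exists y : 'cV[R]_k, [/\ forall i, 0 <= y i 0, \sum_i y i 0 = 1 &
    forall v : 'cV[R]_k, (forall i, 0 <= v i 0) -> \sum_i v i 0 = 1 ->
      \sum_i y i 0 * (\sum_j a i j * y j 0) <= \sum_i v i 0 * (\sum_j a i j * v j 0)].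
Proof.
move=> k0.
pose S : set 'rV[R]_k := ([set v | forall i, `[0, 1]%classic (v ord0 i)]
   `&` [set v | \sum_i v ord0 i = 1])%classic.
pose f (v : 'rV[R]_k) := \sum_i v ord0 i * (\sum_j a i j * v ord0 j).
have SE (v : 'cV[R]_k) : (forall i, 0 <= v i 0) -> \sum_i v i 0 = 1 -> S v^T.
  move=> v0 v1; split=> /= [i|]; last by under eq_bigr do rewrite mxE.
  rewrite in_itv /= mxE v0 /= -v1 (bigD1 i) //= lerDl; exact: sumr_ge0.
have S0 : (S !=set0)%classic.
  exists (delta_mx 0 (Ordinal k0)).
  split=> /= [i|].
    by rewrite in_itv /= mxE eqxx /= ler0n lern1 leq_b1.
  rewrite (bigD1 (Ordinal k0)) //= big1 => [|i /negbTE ik].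
    by rewrite !mxE !eqxx addr0.
  by rewrite !mxE ik andbF.
have coordC i : continuous (fun v : 'rV[R]_k => v ord0 i).
  exact: coord_continuous.
have sumC (F : 'I_k -> 'rV[R]_k -> R) : (forall i, continuous (F i)) ->
    continuous (fun v => \sum_i F i v).
  by move=> Fc; apply: continuous_big => //; exact: add_continuous.
have cS : compact S.
  apply: compact_closedI.
    by apply: (@rV_compact R k (fun=> `[0, 1]%classic)) => i; exact: segment_compact.
  apply: (@preimage_closed _ _ (fun v : 'rV[R]_k => \sum_i v ord0 i) [set x | x = 1]%classic).
    by move=> v _; exact: sumC.
  exact: closed_eq.
have fc : continuous f.
  apply: (sumC) => i v; apply: continuousM; first exact: coordC.
  apply: (sumC) => j w; apply: continuousM; first exact: cst_continuous.
  exact: coordC.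
have [y] := EVT_min_rV S0 cS (continuous_subspaceT fc).
rewrite inE => -[/= y0 y1] ymin; exists y^T; split.
- by move=> i; rewrite mxE; have := y0 i; rewrite in_itv /= => /andP[].
- by under eq_bigr do rewrite mxE.
- move=> v v0 v1; have := ymin v^T; rewrite inE => /(_ (SE v v0 v1)).
  rewrite /f; congr (_ <= _); apply: eq_bigr => i _; rewrite mxE; congr (_ * _);
  by apply: eq_bigr => j _; rewrite mxE.
Qed.

Lemma Isp_solution {k} (A : 'M[C]_k) : (0 < k)%N -> psd A ->
  (forall i j, 0 <= A i j) -> (forall i, A i i != 0) -> Isp A = Ind A ->
  exists u : 'cV[R]_k, (forall i, 0 <= u i 0) /\ A *m cvC u = p.
Proof.
move=> k0 pA A0 Aii IE; pose a i j := complex.Re (A i j).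
have aE i j : A i j = (a i j)%:C by case: (Re_nonneg _ (A0 i j)).
have a0 i j : 0 <= a i j by case: (Re_nonneg _ (A0 i j)).
have [y [y0 y1]] := simplex_quad_min a k0.
pose f (v : 'cV[R]_k) := \sum_i v i 0 * (\sum_j a i j * v j 0).
have fE v : dot (cvC v) (A *m cvC v) = (f v)%:C.
  rewrite dotE rmorph_sum; apply: eq_bigr => i _.
  rewrite [cvC v i 0]mxE realC_conj rmorphM mxE rmorph_sum; congr (_ * _).
  by apply: eq_bigr => j _; rewrite mxE aE rmorphM.
rewrite -/(f y) => ymin.
(* Some [y_i] is positive and [A_ii > 0], so the term [a_ii y_i^2] makes the form positive, as
   [Isp_ge] and the final division by [f y] require. *)
have f0 : 0 < f y.
  have term i : 0 <= y i 0 * (\sum_j a i j * y j 0).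
    by rewrite mulr_ge0 // sumr_ge0 // => j _; rewrite mulr_ge0.
  have [i yi] : exists i, 0 < y i 0.
    apply/existsP; apply: contraT => /existsPn H.
    have : \sum_i y i 0 <= 0 by apply: sumr_le0 => i _; rewrite leNgt.
    by rewrite y1 ler10.
  rewrite /f (bigD1 i) //= ltr_pwDl //; last exact: sumr_ge0.
  rewrite mulr_gt0 // (bigD1 i) //= ltr_pwDl //.
    rewrite mulr_gt0 // lt_neqAle a0 andbT eq_sym.
    by have := Aii i; rewrite aE; apply: contra => /eqP ->.
  by apply: sumr_ge0 => j _; rewrite mulr_ge0.
(* The minimum is pinched: [Ind A <= f y <= Isp A = Ind A]. *)
have fI : Ind A = f y.
  apply/eqP; rewrite eq_le -lecR -fE Ind_le //= -IE.
  by apply: Isp_ge => // v v0 v1; rewrite fE lecR ymin.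
have pI := Ind_psd A k0 pA.
have q0 : dot (cvC y) ((A - (Ind A)%:C *: ones R k) *m cvC y) = 0.
  by rewrite dot_sub_ones dot_p_cvC y1 normr1 expr1n mulr1 fE fI subrr.
have := psd_dot_eq0 _ _ pI q0; rewrite mulmxBl => /eqP; rewrite subr_eq0 => /eqP Ay.
exists ((f y)^-1 *: y); split=> [i|]; first by rewrite mxE mulr_ge0 // invr_ge0 ltW.
have -> : cvC ((f y)^-1 *: y) = ((f y)^-1)%:C *: cvC y.
  by apply/matrixP => i j; rewrite !mxE rmorphM.
rewrite -scalemxAr Ay -scalemxAl scalerA fI -rmorphM mulVf ?gt_eqF // scale1r.
apply/matrixP => i j; rewrite ord1 mxE [RHS]mxE -[RHS]/((1:R)%:C) -y1 rmorph_sum.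
by apply: eq_bigr => l _; rewrite !mxE mul1r.
Qed.

(** * Principal submatrices and the support of a solution *)

(** Compression by the coordinate inclusion [E] makes positivity of principal submatrices
    immediate. *)
Lemma princE {k} (J : {set 'I_k}) (A : 'M[C]_k) :
  let E := \matrix_(i, a) (i == enum_val (A := mem J) a)%:R in
  princ J A = ctr E *m A *m E.
Proof.
move=> E; apply/matrixP => a b; rewrite !mxE (bigD1 (enum_val b)) //= !mxE eqxx mulr1.
rewrite [X in _ = _ + X]big1 ?addr0 => [|j /negbTE jb]; last by rewrite !mxE jb mulr0.
rewrite (bigD1 (enum_val a)) //= !mxE eqxx conjC1 mul1r.
by rewrite big1 ?addr0 // => j /negbTE ja; rewrite !mxE ja conjC0 mul0r.
Qed.

Lemma psd_princ {k} (J : {set 'I_k}) (A : 'M[C]_k) : psd A -> psd (princ J A).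
Proof.
move=> pA; rewrite princE; apply/psdE; split.
  by rewrite !ctr_mul ctrK (proj1 pA) mulmxA.
by move=> z; rewrite -!mulmxA dot_adj ctrK psd_dot_ge0.
Qed.

(** Coordinates outside the support [J] contribute zero to every sum, so restricting [u] preserves
    its total and the equations indexed by [J]. An empty support would give [A u = 0]. *)
Lemma princ_solution {k} (A : 'M[C]_k) (u : 'cV[R]_k) : (0 < k)%N ->
  A *m cvC u = p ->
  let J := [set i | u i 0 != 0] in
  let uJ : 'cV[R]_#|J| := \col_a u (enum_val a) 0 in
  [/\ (0 < #|J|)%N, \sum_a uJ a 0 = \sum_i u i 0 & princ J A *m cvC uJ = p].
Proof.
move=> k0 Au J uJ.
have sumJ (V : nmodType) (F : 'I_k -> V) : (forall i, u i 0 = 0 -> F i = 0) ->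
    \sum_(a < #|J|) F (enum_val a) = \sum_i F i.
  move=> F0; rewrite -(big_enum_val (A := mem J) F) [RHS](bigID (mem J)) /=.
  rewrite [X in _ = _ + X]big1 ?addr0 // => i.
  by rewrite inE negbK => /eqP/F0.
split.
- rewrite lt0n; apply: contraTneq isT => /eqP; rewrite cards_eq0 => /eqP J0.
  have u0 : cvC u = 0.
    apply/matrixP => i j; rewrite ord1 !mxE.
    have : i \notin J by rewrite J0 inE.
    by rewrite inE negbK => /eqP ->.
  move: Au; rewrite u0 mulmx0 => /matrixP/(_ (Ordinal k0) 0); rewrite !mxE.
  by move/esym/eqP; rewrite oner_eq0.
- by rewrite -[RHS]sumJ //; apply: eq_bigr => a _; rewrite mxE.
- apply/matrixP => a b; rewrite ord1 !mxE.
  have /matrixP/(_ (enum_val a) 0) := Au; rewrite !mxE => <-.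
  rewrite -[RHS]sumJ => [|i ui]; last by rewrite mxE ui rmorph0 mulr0.
  by apply: eq_bigr => c _; rewrite !mxE.
Qed.

End HadamardIndices.

Theorem theorem2p8 (R : realType) (n : nat) (A : 'M[R[i]]_n) :
  (0 < n)%N ->
  psd A ->
  (forall i j, 0 <= A i j) ->
  (forall i, A i i != 0) ->
  ((exists u : 'cV[R]_n, (forall i, 0 <= u i 0) /\ A *m cvC u = const_mx 1)
     <-> Isp A = Ind A)
  /\
  (forall u : 'cV[R]_n, (forall i, 0 <= u i 0) -> A *m cvC u = const_mx 1 ->
     let y : 'cV[R]_n := Ind A *: u in
     let x : 'cV[R[i]]_n := cvC (map_mx Num.sqrt y) in
     let J : {set 'I_n} := [set i | u i 0 != 0] in
     (vnorm x = 1 /\ specnorm (hadamard A (x *m ctr x)) = Isp A)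
     /\ (Ind A = Ind (princ J A) /\ Ind (princ J A) = Isp (princ J A)
         /\ Isp (princ J A) = Isp A)).
Proof.
move=> n0 pA A0 Aii; split.
  split=> [[u [u0 Au]]|]; last exact: Isp_solution.
  by case: (solution_Isp A u n0 pA A0 u0 Au).
move=> u u0 Au y x J.
have [x1 xI AI] := solution_Isp A u n0 pA A0 u0 Au.
have [J0 sJ AJ] := princ_solution A u n0 Au.
have pJ := psd_princ J A pA.
have [] := solution_Isp _ _ J0 pJ _ _ AJ.
- by move=> i j; rewrite mxE.
- by move=> i; rewrite mxE.
move=> _ _ JI.
have [_ IA] := Ind_solution A u n0 pA Au.
have [_ IJ] := Ind_solution _ _ J0 pJ AJ.
(* Both indices are the reciprocal of the same coordinate sum. *)
have E : Ind A = Ind (princ J A) by rewrite IA IJ sJ.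
by split=> //; rewrite JI AI -E.
Qed.
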